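(* There exists a (topologically) strongly mixing dynamical system which is not a van der Waerden system.
   Context: A (topological) dynamical system $(X,T)$ consists of a (nonempty) compact metric space and a continuous map $T\colon X\to X$. $\mathbb{N}$ is the set of positive integers. $(X,T)$ is strongly mixing if for every two non-empty open $U,V\subset X$ the set $N(U,V)=\{n\in\mathbb{N}:T^nU\cap V\ne\emptyset\}$ is cofinite in $\mathbb{N}$. $(X,T)$ is a van der Waerden system if for every non-empty open $U\subset X$ and every $d\in\mathbb{N}$ there exists $n\in\mathbb{N}$ such that $U\cap T^{-n}U\cap T^{-2n}U\cap\dots\cap T^{-dn}U\ne\emptyset$. *)

(* Defs.v *)
From HB Require Import structures.
From mathcomp Require Import all_boot all_order all_algebra.
From mathcomp Require Import all_classical all_reals all_analysis.

Set Implicit Arguments.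
Unset Strict Implicit.
Unset Printing Implicit Defensive.

Local Open Scope classical_set_scope.

Record dynamical_system (R : realType) := DynamicalSystem {
  phase_space :> metricType R;
  ds_map : phase_space -> phase_space;
  phase_space_nonempty : [set: phase_space] !=set0;
  phase_space_compact : compact [set: phase_space];
  ds_map_continuous : continuous ds_map
}.

(* In the source, N is the set of positive integers, whereas [nat] contains 0.
   Hence the explicit positivity conditions below; without [(0 < n)%N], the
   choice [n = 0] would make every system a van der Waerden system. *)
Definition positive_nat : set nat := [set n | (0 < n)%N].

Section dynamical_properties.
Context {R : realType} (S : dynamical_system R).

(* N(U, V) = {n in N : T^n U meets V} *)
Definition hitting_times (U V : set S) : set nat :=
  [set n | positive_nat n /\ (iter n (@ds_map R S) @` U) `&` V !=set0].

Definition strongly_mixing : Prop :=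
  forall U V : set S, open U -> U !=set0 -> open V -> V !=set0 ->
    finite_set (positive_nat `\` hitting_times U V).

(* The term [k = 0] of the intersection is U itself. *)
Definition van_der_Waerden_system : Prop :=
  forall U : set S, open U -> U !=set0 ->
  forall d : nat, positive_nat d ->
  exists n : nat, positive_nat n /\
    \bigcap_(k in [set k | (k <= d)%N])
       (iter (k * n)%N (@ds_map R S) @^-1` U) !=set0.

End dynamical_properties.

(* Main.v *)
Require Import Defs.
From HB Require Import structures.
From mathcomp Require Import all_boot all_order all_algebra.
From mathcomp Require Import all_classical all_reals all_analysis.
From mathcomp Require Import zify.

(** The system is the one-sided shift on the subsets of nat (as indicator
    sequences) that contain no three-term arithmetic progression.  This
    condition only forbids finite patterns, so it defines a compact
    shift-invariant subspace of the Cantor space.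

    It is strongly mixing because progression-free finite sets can be combined
    freely at large distance: if A and B are progression-free, A lies in
    [0, m], B lies in [0, p] and N > 2 (m + p), then the union of A and B + N
    is progression-free.  Indeed a progression with two terms in one of the two
    blocks has a difference too small for the third to cross the gap
    ([apfree_glue]).  Hence, for all large N, a point of any
    given cylinder can be continued so that its N-th shift lies in any other
    given cylinder.

    It is not a van der Waerden system because a point x of the open set
    [x 0 = true] which returns there at the times n and 2 n would contain the
    progression 0, n, 2 n. *)

Set Implicit Arguments.
Unset Strict Implicit.
Unset Printing Implicit Defensive.

Import Order.TTheory GRing.Theory Num.Theory.

Local Open Scope classical_set_scope.
Local Open Scope ring_scope.

(** * Progression-free sequences *)

Definition apfree (x : nat -> bool) : Prop :=
  forall a r : nat, (0 < r)%N -> x a -> x (a + r)%N -> x (a + r + r)%N -> False.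

Definition glue (m p N : nat) (x y : nat -> bool) : nat -> bool := fun k =>
  ((k <= m)%N && x k) || [&& (N <= k)%N, (k - N <= p)%N & y (k - N)%N].

(** The gap [m, N] is longer than both blocks, so a progression meeting both
    blocks would need one step across the gap and one step inside a block. *)
Lemma apfree_glue m p N x y : (2 * (m + p) < N)%N ->
  apfree x -> apfree y -> apfree (glue m p N x y).
Proof.
move=> mpN xfree yfree a r r_gt0.
rewrite /glue => /orP[/andP[am xa]|/and3P[Na ap ya]].
- move=> /orP[/andP[arm xar]|/and3P[Nar arp _]].
    move=> /orP[/andP[_ xarr]|/and3P[Narr _ _]]; last lia.
    exact: xfree r_gt0 xa xar xarr.
  by move=> /orP[/andP[arrm _]|/and3P[_ arrp _]]; lia.
- move=> /orP[/andP[arm _]|/and3P[_ _ yar]]; first lia.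
  move=> /orP[/andP[arrm _]|/and3P[_ _ yarr]]; first lia.
  have arE : (a + r - N = a - N + r)%N by lia.
  have arrE : (a + r + r - N = a - N + r + r)%N by lia.
  by rewrite arE in yar; rewrite arrE in yarr; exact: yfree r_gt0 ya yar yarr.
Qed.

Lemma glue_left m p N x y k : (m < N)%N -> (k <= m)%N ->
  glue m p N x y k = x k.
Proof.
move=> mN km; rewrite /glue km /= leqNgt (leq_ltn_trans km mN) /=.
by rewrite orbF.
Qed.

Lemma glue_right m p N x y k : (m < N)%N -> (k <= p)%N ->
  glue m p N x y (N + k)%N = y k.
Proof.
move=> mN kp; rewrite /glue leq_addr addKn kp /=.
by rewrite leqNgt (leq_trans mN (leq_addr _ _)).
Qed.

(** * The compact metric space of progression-free sequences *)

(** The index [R] fixes the field in which distances are measured, so that the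
    metric and the topology below are determined by the type alone. *)
Record apspace (R : realType) := APSpace {
  apseq :> nat -> bool;
  apseq_free : apfree apseq
}.

Arguments apseq_free {R} _ [a r].

HB.instance Definition _ (R : realType) := gen_eqMixin (apspace R).
HB.instance Definition _ (R : realType) := gen_choiceMixin (apspace R).

Section apspace_metric.
Context {R : realType}.
Implicit Types x y z : apspace R.

Lemma apspace_ext x y : (forall n, x n = y n) -> x = y.
Proof.
case: x y => [x xf] [y yf] /= /funext xy; rewrite -{y}xy in yf *.
by congr APSpace; exact: Prop_irrelevance.
Qed.

(** One of the usual metrics of the Cantor space.  Its balls of radius
    1 / (n + 1) are exactly the cylinders over the coordinates 0, ..., n
    ([apdist_lt]), and these describe the topology. *)
Definition apdist x y : R :=
  if pselect (exists n, x n != y n) is left xy then (ex_minn xy).+1%:R^-1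
  else 0.

Variant apdist_spec x y : R -> Prop :=
| ApdistEq of x = y : apdist_spec x y 0
| ApdistNeq n of x n != y n & (forall k, (k < n)%N -> x k = y k) :
    apdist_spec x y n.+1%:R^-1.

Lemma apdistP x y : apdist_spec x y (apdist x y).
Proof.
rewrite /apdist; case: pselect => [xy|xy].
  case: ex_minnP => n xyn minn; constructor => // k kn.
  by apply/eqP; apply: contraTT kn => /minn; rewrite -leqNgt.
constructor; apply: apspace_ext => n.
by apply/eqP; apply: contrapT => /negP xyn; apply: xy; exists n.
Qed.

Lemma apdist_ge x y n : x n != y n -> n.+1%:R^-1 <= apdist x y.
Proof.
case: apdistP => [->|m xym xyk xyn]; first by rewrite eqxx.
rewrite lef_pV2 ?posrE// ler_nat ltnS leqNgt.
by apply: contra xyn => /xyk/eqP.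
Qed.

Lemma apdist_ge0 x y : 0 <= apdist x y.
Proof. by case: apdistP => // n _ _; rewrite invr_ge0. Qed.

Lemma apdist_lt x y n :
  apdist x y < n.+1%:R^-1 <-> forall k, (k <= n)%N -> x k = y k.
Proof.
split=> [xyn k kn|].
  apply/eqP; apply: contraTT xyn => /apdist_ge xyk; rewrite -leNgt.
  by apply: le_trans xyk; rewrite lef_pV2 ?posrE// ler_nat.
case: apdistP => [_ _|m xym _ xyn]; first by rewrite invr_gt0.
rewrite ltf_pV2 ?posrE// ltr_nat ltnS ltnNge.
by apply: contra xym => /xyn/eqP.
Qed.

Lemma apdistxx x : apdist x x = 0.
Proof. by case: apdistP => // n; rewrite eqxx. Qed.

Lemma apdist_positivity x y : apdist x y = 0 -> x = y.
Proof.
case: apdistP => // n _ _ /eqP.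
by rewrite invr_eq0 pnatr_eq0.
Qed.

Lemma apdist_sym x y : apdist x y = apdist y x.
Proof.
suff le_sym u v : apdist u v <= apdist v u by apply/eqP; rewrite eq_le !le_sym.
case: (apdistP u v) => [_|n uvn _]; first exact: apdist_ge0.
by apply: apdist_ge; rewrite eq_sym.
Qed.

(** At the first index where x and z differ, y has to differ from one of them,
    so one of the two terms on the right already dominates. *)
Lemma apdist_triangle y x z : apdist x z <= apdist x y + apdist y z.
Proof.
case: (apdistP x z) => [_|n xzn _]; first by rewrite addr_ge0 ?apdist_ge0.
have [xyn|/apdist_ge xyn] := eqVneq (x n) (y n); last first.
  by rewrite (le_trans xyn)// lerDl apdist_ge0.
rewrite xyn in xzn.
by rewrite (le_trans (apdist_ge xzn))// lerDr apdist_ge0.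
Qed.

End apspace_metric.

HB.instance Definition _ (R : realType) := @isMetric.Build R (apspace R)
  apdist apdistxx apdist_positivity apdist_sym apdist_triangle.

Section apspace_topology.
Context {R : realType}.
Implicit Types x y z : apspace R.

Definition cylinder x (n : nat) : set (apspace R) :=
  [set y | forall k, (k <= n)%N -> x k = y k].

Lemma nbhs_cylinderP x (U : set (apspace R)) :
  nbhs x U <-> exists n, cylinder x n `<=` U.
Proof.
split=> [/nbhs_ballP[e /= e_gt0 xU]|[n xU]].
  have [n _ /(_ n (leqnn n)) ne] := near_infty_natSinv_lt (PosNum e_gt0).
  exists n => y /apdist_lt xyn; apply: xU; rewrite ballEmdist /=.
  exact: lt_trans xyn ne.
apply/nbhs_ballP; exists n.+1%:R^-1; first by rewrite /= invr_gt0.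
by move=> y; rewrite ballEmdist => /apdist_lt xyn; exact: xU.
Qed.

Lemma open_coordinate (n : nat) : open [set x : apspace R | x n].
Proof.
rewrite openE => x /= xn; apply/nbhs_cylinderP; exists n => y /= xy.
by rewrite -xy.
Qed.

(** The coordinates of the limit of an ultrafilter are those decided by the
    ultrafilter.  The limit is progression-free because three coordinates are
    decided simultaneously by some point of the space. *)
Lemma apspace_compact : compact [set: apspace R].
Proof.
rewrite compact_ultra => F UF _.
pose l n := `[< F [set y : apspace R | y n] >].
have lfree : apfree l.
  move=> a r r_gt0 /asboolP Fa /asboolP Far /asboolP Farr.
  have [y [[ya yar] yarr]] := filter_ex (filterI (filterI Fa Far) Farr).
  exact: (apseq_free y r_gt0 ya yar yarr).
exists (APSpace R lfree); split=> // U /nbhs_cylinderP[n lU].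
rewrite nbhs_filterE; apply: filterS lU _.
have Fl k : F [set y : apspace R | l k = y k].
  rewrite /l; case: asboolP => Fk.
    by apply: filterS Fk => y /= yk; rewrite yk.
  have [//|] := in_ultra_setVsetC [set y : apspace R | y k] UF.
  by apply: filterS => y /= /negP/negbTE yk; rewrite yk.
elim: n => [|n IHn].
  by apply: filterS (Fl 0%N) => y l0 k; rewrite leqn0 => /eqP ->.
apply: filterS (filterI IHn (Fl n.+1)) => y [ln lSn] k.
by rewrite leq_eqVlt ltnS => /orP[/eqP ->//|/ln].
Qed.

(** * The shift *)

Lemma apfree_shift (x : nat -> bool) : apfree x -> apfree (fun k => x k.+1).
Proof. by move=> xf a r; exact: xf a.+1 r. Qed.

Definition apshift x : apspace R := APSpace R (apfree_shift (apseq_free x)).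

Lemma iter_apshift N x k : iter N apshift x k = x (N + k)%N.
Proof. by elim: N k => [//|N IHN] k; rewrite iterS /= IHN addnS. Qed.

Lemma apshift_continuous : continuous apshift.
Proof.
move=> x U /nbhs_cylinderP[n xU]; apply/nbhs_cylinderP; exists n.+1 => y xy.
by apply: xU => k kn; exact: xy.
Qed.

Lemma apfree0 : apfree (eq_op 0%N).
Proof. by move=> a r r_gt0 _ /eqP; lia. Qed.

Definition ap_system : dynamical_system R :=
  @DynamicalSystem R (apspace R) apshift (ex_intro _ (APSpace R apfree0) I)
    apspace_compact apshift_continuous.

Lemma ap_system_strongly_mixing : strongly_mixing ap_system.
Proof.
move=> U V oU [x Ux] oV [y Vy].
have /nbhs_cylinderP[m xU] : nbhs x U by exact: open_nbhs_nbhs.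
have /nbhs_cylinderP[p yV] : nbhs y V by exact: open_nbhs_nbhs.
apply: (sub_finite_set _ (finite_II (2 * (m + p)).+1)) => N /= [N_gt0].
apply: contra_notT; rewrite -leqNgt => mpN; split=> //.
have mN : (m < N)%N by lia.
pose z := APSpace R
  (apfree_glue mpN (apseq_free x) (apseq_free y)).
exists (iter N apshift z); split.
  by exists z => //; apply: xU => k km; rewrite [RHS]glue_left.
by apply: yV => k kp; rewrite iter_apshift [RHS]glue_right.
Qed.

Lemma ap_system_not_van_der_Waerden : ~ van_der_Waerden_system ap_system.
Proof.
have U0 : [set x : apspace R | x 0%N] !=set0 by exists (APSpace R apfree0).
move=> /(_ _ (@open_coordinate 0) U0 2%N isT)[n [n_gt0 [x xn]]].
have xkn k : (k <= 2)%N -> x (k * n)%N.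
  by move=> /xn /=; rewrite iter_apshift addn0.
apply: (apseq_free x n_gt0 (xkn 0%N isT)); rewrite add0n.
  by have := xkn 1%N isT; rewrite mul1n.
by have := xkn 2%N isT; rewrite mul2n -addnn.
Qed.

End apspace_topology.

Theorem proposition4p17 (R : realType) :
  exists S : dynamical_system R,
    strongly_mixing S /\ ~ van_der_Waerden_system S.
Proof.
exists ap_system; split.
  exact: ap_system_strongly_mixing.
exact: ap_system_not_van_der_Waerden.
Qed.
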